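(* Let $x_{i+1}=g(x_i)$, $g:\mathbb{R}^n\to\mathbb{R}^n$, be a $\Gamma$-equivariant dynamical system with respect to the actions $\Gamma_\rho=\{\gamma_\rho:\gamma\in\Gamma\}$ on $\mathbb{R}^n$, and let $\mathcal{K}$ be its Koopman operator. Then for every function $f:\mathbb{R}^n\to\mathbb{C}$ and every $\gamma\in\Gamma$, $$\gamma_\rho\circ(\mathcal{K}f)(x)=\mathcal{K}(\gamma_\rho\circ f)(x)\qquad\text{for all }x\in\mathbb{R}^n,$$ i.e. the Koopman operator commutes with the actions of the elements of $\Gamma$ on functions.
   Context: $\Gamma$ is a finite group acting on the state space $\mathbb{R}^n$; the action of $\gamma\in\Gamma$ is denoted $\gamma_\rho:\mathbb{R}^n\to\mathbb{R}^n$ (not necessarily linear), and the set $\Gamma_\rho$ of these actions is a group isomorphic to $\Gamma$. The system $x_{i+1}=g(x_i)$ is $\Gamma$-equivariant with respect to $\Gamma_\rho$ if $g(\gamma_\rho x)=\gamma_\rho g(x)$ for all $x\in\mathbb{R}^n$ and $\gamma_\rho\in\Gamma_\rho$. The Koopman operator $\mathcal{K}$ acts on functions $f:\mathbb{R}^n\to\mathbb{C}$ by $(\mathcal{K}f)(x)=f(g(x))$. The group acts on functions by $(\gamma_\rho\circ f)(x)=f(\gamma_\rho^{-1}x)$. *)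

(* Defs.v *)
(* MathComp world: the real line is an abstract [R : realType], the state space
   R^n is ['rV[R]_n], and the complex numbers over R are [complex R]. *)
From HB Require Import structures.
From mathcomp Require Import all_boot all_algebra all_fingroup.
From mathcomp Require Import boolp classical_sets functions reals complex.

Set Implicit Arguments.
Unset Strict Implicit.
Unset Printing Implicit Defensive.

(* [rho a] is the transformation gamma_rho of T for gamma = a. MathComp's
   [{action gT &-> T}] is a right action; the maps gamma_rho compose as in a
   left action. The last clause says that gamma |-> gamma_rho is injective, so
   that the set of all gamma_rho is a group isomorphic to gT. *)
Definition faithful_left_action (gT : finGroupType) (T : Type)
    (rho : gT -> T -> T) : Prop :=
  [/\ forall x, rho 1%g x = x,
      forall a b x, rho (a * b)%g x = rho a (rho b x)
    & forall a b, rho a =1 rho b -> a = b].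

Definition equivariant (gT : finGroupType) (T : Type) (rho : gT -> T -> T)
    (g : T -> T) : Prop :=
  forall a x, g (rho a x) = rho a (g x).

(* The inverse map of [h]; the default value [id] of ['pinv_] is only used
   outside the range of [h], hence never for a bijective [h]. *)
Definition inv_map (T : Type) (h : T -> T) : T -> T := 'pinv_id [set: T] h.

Lemma inv_mapK (T : Type) (h : T -> T) : bijective h -> cancel h (inv_map h).
Proof. by move=> /bij_inj h_inj x; apply: pinvKV (in2W h_inj) _ _; rewrite inE. Qed.

Lemma inv_mapVK (T : Type) (h : T -> T) : bijective h -> cancel (inv_map h) h.
Proof.
case=> k hk kh x; apply: pinvK; rewrite inE.
by exists (k x) => //; rewrite kh.
Qed.

(* The action of a transformation [h] of T on functions on T. *)
Definition act_fun (T C : Type) (h : T -> T) (f : T -> C) : T -> C :=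
  fun x => f (inv_map h x).

Definition koopman (T C : Type) (g : T -> T) (f : T -> C) : T -> C :=
  fun x => f (g x).

(* Main.v *)
Require Import Defs.
From mathcomp Require Import all_boot all_algebra all_fingroup.
From mathcomp Require Import reals complex.

(** With [h = rho a], the two sides are [f] at [g (inv_map h x)] and at [inv_map h (g x)]. These
    points agree because a map commuting with a bijection commutes with its inverse
    ([inv_map_comm]); [rho a] is bijective with inverse [rho a^-1]. *)

Lemma faithful_left_action_bij (gT : finGroupType) (T : Type)
    (rho : gT -> T -> T) (a : gT) :
  faithful_left_action rho -> bijective (rho a).
Proof.
case=> rho1 rhoM _; exists (rho a^-1%g) => x.
  by rewrite -rhoM mulVg rho1.
by rewrite -rhoM mulgV rho1.
Qed.

Lemma inv_map_comm (T : Type) (h g : T -> T) :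
  bijective h -> (forall x, g (h x) = h (g x)) ->
  forall x, g (inv_map h x) = inv_map h (g x).
Proof.
move=> h_bij gh x.
(* Apply [h] then [inv_map h] to the left side; pulling [h] inside [g] cancels it against the inner
   [inv_map h]. *)
by rewrite -[LHS](inv_mapK h_bij) -gh inv_mapVK.
Qed.

Theorem mainTheorem1 (R : realType) (n : nat) (gT : finGroupType)
    (rho : gT -> 'rV[R]_n -> 'rV[R]_n) (g : 'rV[R]_n -> 'rV[R]_n)
    (rho_act : faithful_left_action rho) (g_equiv : equivariant rho g) :
  forall (f : 'rV[R]_n -> complex R) (a : gT) (x : 'rV[R]_n),
    act_fun (rho a) (koopman g f) x = koopman g (act_fun (rho a) f) x.
Proof.
move=> f a x; rewrite /act_fun /koopman inv_map_comm //.
exact: faithful_left_action_bij.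
Qed.
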